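(* Let $0\le a\le b$ and $c\ge\max\{b,1\}$ be real numbers, let $(X,\sigma)$ with metric $d$ and $(Y,\sigma)=(Y_E,\sigma)$ with metric $\rho_c$ be the systems described in the context (with $E\subset\mathbb{Z}$ chosen as there for $a,b,c$), and equip the product system $(X\times Y,\sigma\times\sigma)$ with the metric $(d\times\rho_c)((x,y),(x',y'))=\max\{d(x,x'),\rho_c(y,y')\}$. Then for every $\varepsilon\in(0,1)$: $$\overline{D}_{\mathrm{int}}(X\times Y,\varepsilon,d\times \rho_{c})=\overline{D}_{\mathrm{int}}^{\mathrm{pre}}(X\times Y,\varepsilon,d\times \rho_{c})=\overline{D}_{\mathrm{int}}^{\mathrm{as}}(X\times Y,d\times \rho_{c})=1+b,$$ $$\underline{D}_{\mathrm{int}}(X\times Y,\varepsilon,d\times \rho_{c})=\underline{D}_{\mathrm{int}}^{\mathrm{pre}}(X\times Y,\varepsilon,d\times \rho_{c})=\underline{D}_{\mathrm{int}}^{\mathrm{as}}(X\times Y,d\times \rho_{c})=1+a,$$ $$\overline{D}_{\mathrm{ext}}(X\times Y,\varepsilon,d\times \rho_{c})=\overline{D}_{\mathrm{ext}}^{\mathrm{pre}}(X\times Y,\varepsilon,d\times \rho_{c})=\overline{D}_{\mathrm{ext}}^{\mathrm{as}}(X\times Y,d\times \rho_{c})=b,$$ $$\underline{D}_{\mathrm{ext}}(X\times Y,\varepsilon,d\times \rho_{c})=\underline{D}_{\mathrm{ext}}^{\mathrm{pre}}(X\times Y,\varepsilon,d\times \rho_{c})=\underline{D}_{\mathrm{ext}}^{\mathrm{as}}(X\times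 Y,d\times \rho_{c})=a.$$
   Context: **Quantities for a $\mathbb{Z}$-action.** Fix $F_n=\{0,1,\dots,n-1\}$, $n\in\mathbb N$. Let $T:W\to W$ be a homeomorphism of a compact metric space $(W,d)$. Put $d_{F_n}(w,z)=\max_{0\le k<n}d(T^kw,T^kz)$; for nonempty $K\subset W$, $s_{F_n}(K,\delta,d)$ is the maximal cardinality of a set $H\subset K$ with $d_{F_n}(w,z)>\delta$ for all distinct $w,z\in H$; $h_{\mathrm{top}}(K,\delta,\{F_n\}_{n\in\mathbb N},d)=\limsup_{n\to\infty}\frac1n\log s_{F_n}(K,\delta,d)$. For $\varepsilon>0$, $w\in W$: - $\Gamma_\varepsilon^{\{F_m\}_{m\in\mathbb N}}(w)=\{z\in W:d(T^kz,T^kw)\le\varepsilon\ \forall k\ge0\}$; - $\Gamma_{\mathrm{as}}(w)=\{z\in W:\lim_{n\to\infty}d(T^nz,T^nw)=0\}$; - $\Phi_\varepsilon(w,\delta,d)=\limsup_{n\to\infty}\frac1n\log s_{F_n}(T^{-n}\Gamma_\varepsilon^{\{F_m\}_{m\in\mathbb N}}(w),\delta,d)$. For a function $q(w,\delta)$ consider the four numbers $\limsup_{\delta\to0}\sup_{w}\frac{q(w,\delta)}{\log(1/\delta)}$, $\liminf_{\delta\to0}\sup_w\frac{q(w,\delta)}{\log(1/\delta)}$, $\sup_w\limsup_{\delta\to0}\frac{q(w,\delta)}{\log(1/\delta)}$, $\sup_w\liminf_{\delta\to0}\frac{q(w,\delta)}{\log(1/\delta)}$. For $q(w,\delta)=h_{\mathrm{top}}(\Gamma_\varepsilon^{\{F_m\}}(w),\delta,\{F_n\},d)$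 these are denoted, in this order, $\overline{D}_{\mathrm{int}}(W,\varepsilon,d)$, $\underline{D}_{\mathrm{int}}(W,\varepsilon,d)$, $\overline{D}_{\mathrm{ext}}(W,\varepsilon,d)$, $\underline{D}_{\mathrm{ext}}(W,\varepsilon,d)$. For $q=\Phi_\varepsilon(w,\delta,d)$ they carry the superscript $\mathrm{pre}$: $\overline{D}^{\mathrm{pre}}_{\mathrm{int}}(W,\varepsilon,d)$, etc. For $q(w,\delta)=h_{\mathrm{top}}(\Gamma_{\mathrm{as}}(w),\delta,\{F_n\},d)$ they carry the superscript $\mathrm{as}$: $\overline{D}^{\mathrm{as}}_{\mathrm{int}}(W,d)$, etc. **The system $X$.** $\sigma$ is the left shift. On $[0,2]^{\mathbb Z}$ use $d(x,y)=\sup_{n\in\mathbb Z}\frac{|x_n-y_n|}{2^{|n|}}$. Let $X^{(0)}$ consist of $0^{\mathbb Z}$ and all $x\in\{0,2\}^{\mathbb Z}$ with exactly one coordinate equal to $2$. For $n\in\mathbb N=\{1,2,\dots\}$ let $G_n=\{2^{-n}+k2^{-n^2}:k=1,\dots,2^{n^2-n}\}$. Fix a strictly increasing sequence $\{P_m\}_{m\in\mathbb N}$ in $\mathbb N$, let $X_n=\{x\in(G_n\cup\{2\})^{\mathbb Z}: x_i=2 \text{ if } i\equiv0\ (\mathrm{mod}\ P_n),\ x_i\in G_n\text{ otherwise}\}$, $X^{(n)}=\bigcup_{i\in\mathbb Z}\sigma^iX_n$, and $X=\bigcup_{n\ge0}X^{(n)}$ (a closed shift-invariant subset of $[0,2]^{\mathbb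 Z}$). **The system $Y=Y_E$.** For $E\subset\mathbb Z$, $\Lambda_E=\{x\in\{0,1\}^{\mathbb Z}:x_i=0\text{ for } i\in E\}$ with the metric $d$ given by the same formula, and $Y_E=\Lambda_E^{\mathbb Z}$ with the left shift $\sigma$ (shifting the outer index), $\rho((x^{(n)})_n,(y^{(n)})_n)=\sup_{m\in\mathbb Z}\frac{d(x^{(m)},y^{(m)})}{2^{|m|}}$ and $\rho_c=\rho^{1/c}$. The set $E$ is chosen (such $E$ exists for all $0\le a\le b$, $c\ge\max\{1,b\}$) so that for every $\varepsilon>0$ all of $\overline{D}_{\mathrm{int}},\overline{D}_{\mathrm{ext}},\overline{D}^{\mathrm{pre}}_{\mathrm{int}},\overline{D}^{\mathrm{pre}}_{\mathrm{ext}}$ of $(Y_E,\varepsilon,\rho_c)$ and $\overline{D}^{\mathrm{as}}_{\mathrm{int}},\overline{D}^{\mathrm{as}}_{\mathrm{ext}}$ of $(Y_E,\rho_c)$ equal $b$, and all of the corresponding quantities with $\underline{D}$ in place of $\overline{D}$ equal $a$. *)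

(* Defs.v *)
From HB Require Import structures.
From mathcomp Require Import all_boot all_order all_algebra.
From mathcomp Require Import all_classical all_reals all_analysis.

Set Implicit Arguments.
Unset Strict Implicit.
Unset Printing Implicit Defensive.

Import Order.TTheory GRing.Theory Num.Theory.
Import numFieldNormedType.Exports.

Local Open Scope classical_set_scope.
Local Open Scope ring_scope.

(* A Z-action on a metric space W, with W presented as a subset [phase] of an
   ambient type: [tmap] and [tdist] are only ever used on points of [phase],
   which is meant to be a compact metric space on which [tmap] is a
   homeomorphism. *)
Record dynsys (R : realType) := DynSys {
  ambient : Type;
  phase : set ambient;
  tmap : ambient -> ambient;
  tdist : ambient -> ambient -> R
}.

Section Quantities.
Context {R : realType} (S : dynsys R).
Local Notation M := (ambient S).
Local Notation W := (@phase R S).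
Local Notation T := (@tmap R S).
Local Notation d := (@tdist R S).
Implicit Types (n : nat) (w z : M) (K H : set M) (delta eps : R).

Definition bowen_dist n w z : R :=
  \big[Num.max/0]_(k < n) d (iter k T w) (iter k T z).

Definition bowen_separated n delta H : Prop :=
  forall w z, H w -> H z -> w <> z -> delta < bowen_dist n w z.

(* The supremum of the sizes m of finite separated subsets of K; it is a
   maximum as soon as it is finite. *)
Definition sep_number n K delta : \bar R :=
  ereal_sup [set m%:R%:E | m in
    [set m : nat | exists H, [/\ H `<=` K, (H #= `I_m)%card & bowen_separated n delta H]]].

Definition htop K delta : \bar R :=
  limn_esup (fun n => (lne (sep_number n K delta) / n%:R%:E)%E).

Definition stable_set eps w : set M :=
  [set z | W z /\ forall k, d (iter k T z) (iter k T w) <= eps].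

Definition asymptotic_set w : set M :=
  [set z | W z /\ d (iter n T z) (iter n T w) @[n --> \oo] --> (0 : R)].

Definition preimage_iter n K : set M := [set z | W z /\ K (iter n T z)].

Definition preimage_entropy eps w delta : \bar R :=
  limn_esup (fun n =>
    (lne (sep_number n (preimage_iter n (stable_set eps w)) delta)
      / n%:R%:E)%E).

Section Dimensions.
Variable q : M -> R -> \bar R.

Definition rate w delta : \bar R := (q w delta / (ln delta^-1)%:E)%E.

Definition limsup_sup : \bar R :=
  limf_esup (fun delta : R => ereal_sup [set rate w delta | w in W]) 0^'+.
Definition liminf_sup : \bar R :=
  limf_einf (fun delta : R => ereal_sup [set rate w delta | w in W]) 0^'+.
Definition sup_limsup : \bar R :=
  ereal_sup [set limf_esup (rate w) 0^'+ | w in W].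
Definition sup_liminf : \bar R :=
  ereal_sup [set limf_einf (rate w) 0^'+ | w in W].
End Dimensions.

Definition upD_int eps := limsup_sup (fun w => htop (stable_set eps w)).
Definition loD_int eps := liminf_sup (fun w => htop (stable_set eps w)).
Definition upD_ext eps := sup_limsup (fun w => htop (stable_set eps w)).
Definition loD_ext eps := sup_liminf (fun w => htop (stable_set eps w)).

Definition upD_int_pre eps := limsup_sup (preimage_entropy eps).
Definition loD_int_pre eps := liminf_sup (preimage_entropy eps).
Definition upD_ext_pre eps := sup_limsup (preimage_entropy eps).
Definition loD_ext_pre eps := sup_liminf (preimage_entropy eps).

Definition upD_int_as := limsup_sup (fun w => htop (asymptotic_set w)).
Definition loD_int_as := liminf_sup (fun w => htop (asymptotic_set w)).
Definition upD_ext_as := sup_limsup (fun w => htop (asymptotic_set w)).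
Definition loD_ext_as := sup_liminf (fun w => htop (asymptotic_set w)).
End Quantities.

Definition prod_sys (R : realType) (S1 S2 : dynsys R) : dynsys R :=
  @DynSys R (ambient S1 * ambient S2)%type
    (@phase R S1 `*` @phase R S2)
    (fun p => (tmap p.1, tmap p.2))
    (fun p p' => Num.max (tdist p.1 p'.1) (tdist p.2 p'.2)).

Definition zshift (A : Type) (i : int) (x : int -> A) : int -> A :=
  fun j => x (j + i).

(* The real supremum is only meaningful when d0 is bounded on the
   coordinates involved, as it is on the systems below. *)
Definition seq_dist (R : realType) (A : Type) (d0 : A -> A -> R)
    (x y : int -> A) : R :=
  sup [set d0 (x n) (y n) / 2 ^+ `|n|%N | n in [set: int]].

Definition coord_dist (R : realType) : (int -> R) -> (int -> R) -> R :=
  seq_dist (fun s t : R => `|s - t|).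

Section SystemX.
Context {R : realType} (P : nat -> nat).

Definition X_zero : set (int -> R) :=
  [set x | (forall i, x i = 0) \/
           exists i, x i = 2 /\ forall j, j <> i -> x j = 0].

Definition G (n : nat) : set R :=
  [set (2 ^- n + k%:R * 2 ^- (n ^ 2)%N) | k in
    [set k | (1 <= k <= 2 ^ (n ^ 2 - n))%N]].

Definition X_base (n : nat) : set (int -> R) :=
  [set x | forall i : int,
     ((i = 0 %[mod (P n)%:Z])%Z -> x i = 2) /\
     (~ (i = 0 %[mod (P n)%:Z])%Z -> G n (x i))].

Definition X_pos (n : nat) : set (int -> R) :=
  \bigcup_(i in [set: int]) (zshift i @` X_base n).

Definition X_space : set (int -> R) :=
  X_zero `|` \bigcup_(n in [set n | (1 <= n)%N]) X_pos n.

Definition X_sys : dynsys R :=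
  @DynSys R (int -> R) X_space (zshift 1) (@coord_dist R).
End SystemX.

Section SystemY.
Context {R : realType}.

Definition Lambda (E : set int) : set (int -> R) :=
  [set x | forall i, (x i = 0 \/ x i = 1) /\ (E i -> x i = 0)].

Definition Y_space (E : set int) : set (int -> int -> R) :=
  [set y | forall m, Lambda E (y m)].

Definition rho : (int -> int -> R) -> (int -> int -> R) -> R :=
  seq_dist (@coord_dist R).

Definition Y_sys (E : set int) (c : R) : dynsys R :=
  @DynSys R (int -> int -> R) (Y_space E) (zshift 1)
    (fun x y => rho x y `^ c^-1).

Definition realizes (a b c : R) (E : set int) : Prop :=
  let Y := Y_sys E c in
  [/\ (forall eps : R, 0 < eps ->
        [/\ upD_int Y eps = b%:E, upD_ext Y eps = b%:E,
            upD_int_pre Y eps = b%:E & upD_ext_pre Y eps = b%:E]),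
      upD_int_as Y = b%:E /\ upD_ext_as Y = b%:E,
      (forall eps : R, 0 < eps ->
        [/\ loD_int Y eps = a%:E, loD_ext Y eps = a%:E,
            loD_int_pre Y eps = a%:E & loD_ext_pre Y eps = a%:E])
    & loD_int_as Y = a%:E /\ loD_ext_as Y = a%:E].
End SystemY.

(* Main.v *)
Require Import Defs.
From HB Require Import structures.
From mathcomp Require Import all_boot all_order all_algebra.
From mathcomp Require Import all_classical all_reals all_analysis.
From mathcomp Require Import zify ring lra.
Import Order.TTheory GRing.Theory Num.Theory.
Import numFieldNormedType.Exports.
Local Open Scope classical_set_scope.
Local Open Scope ring_scope.

(** Stable, preimage and asymptotic sets of the product are products K x L, so
    everything reduces to comparing the entropy of K x L at scale delta with that
    of L.  If the symbols of K fall into M classes of diameter at most delta, a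
    separated subset of K x L splits into about M^n pieces whose projections to L
    are separated, which adds at most ln M; conversely N^n separated words in K
    add ln N.  Uniformly in the point of X one has M ~ 2 / delta, which adds 1
    after division by ln (1 / delta), and this is attained by the points of X^(m)
    with 2^-(m+1)^2 <= delta < 2^-m^2.  For a fixed point of X the 2s in its
    orbit force all relevant points to lie in the same X^(m), whose alphabet is
    finite, so nothing is added in the limit. *)

(** * Upper and lower limits under a shift by a finite constant *)

(** For each member [V] of the filter, its intersection with the set where the bound holds is again
    a member and competes in the infimum defining the limsup of [f]. The slack [e] is removed at the
    end. *)
Lemma limf_esup_le_shift (R : realType) (T : choiceType) (X : filteredType T)
    (F : set_system X) {FF : Filter F} (f g : X -> \bar R) (l : R) :
  (forall e, 0 < e -> \forall x \near F, (f x <= (l + e)%:E + g x)%E) ->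
  (limf_esup f F <= l%:E + limf_esup g F)%E.
Proof.
move=> fg; apply/lee_addgt0Pr => e e0.
rewrite addeAC -EFinD -leeBlDl//; apply: le_ereal_inf_tmp => _ [V FV <-].
rewrite leeBlDl//.
have FU := filterI FV (fg e e0).
apply: (@le_trans _ _ (ereal_sup (f @` (V `&` [set x | (f x <= (l + e)%:E + g x)%E])))).
  by apply: ereal_inf_lbound; eexists; first exact: FU.
apply: ge_ereal_sup => _ [x [Vx /= fx] <-]; apply: (le_trans fx).
by rewrite leeD2l//; apply: ereal_sup_ubound; exists x.
Qed.

Lemma limf_esup_ge_shift (R : realType) (T : choiceType) (X : filteredType T)
    (F : set_system X) {FF : Filter F} (f g : X -> \bar R) (l : R) :
  (forall e, 0 < e -> \forall x \near F, ((l - e)%:E + g x <= f x)%E) ->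
  (l%:E + limf_esup g F <= limf_esup f F)%E.
Proof.
move=> fg; rewrite -leeBrDl// addeC -EFinN; apply: limf_esup_le_shift => e e0.
near=> x; rewrite -leeBlDl// -EFinN opprD opprK addeC.
by near: x; exact: fg.
Unshelve. all: by end_near. Qed.

(** Since [limf_einf] is the negative of a [limf_esup], a finite shift has to pass through negation
    while [x] and [y] may be infinite. *)
Lemma leeNl_shift (R : realType) (l : R) (x y : \bar R) :
  (- x <= l%:E - y)%E = ((- l)%:E + y <= x)%E.
Proof. by rewrite leeNl oppeD ?fin_num_adde_defr// oppeK. Qed.

Lemma leeNr_shift (R : realType) (l : R) (x y : \bar R) :
  (l%:E - y <= - x)%E = (x <= (- l)%:E + y)%E.
Proof. by rewrite leeNr oppeD ?fin_num_adde_defr// oppeK. Qed.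

Lemma limf_einf_le_shift (R : realType) (T : choiceType) (X : filteredType T)
    (F : set_system X) {FF : Filter F} (f g : X -> \bar R) (l : R) :
  (forall e, 0 < e -> \forall x \near F, (f x <= (l + e)%:E + g x)%E) ->
  (limf_einf f F <= l%:E + limf_einf g F)%E.
Proof.
move=> fg; rewrite /limf_einf leeNl_shift.
apply: limf_esup_ge_shift => e e0; near=> x.
rewrite -opprD leeNr_shift opprK.
by near: x; exact: fg.
Unshelve. all: by end_near. Qed.

Lemma limf_einf_ge_shift (R : realType) (T : choiceType) (X : filteredType T)
    (F : set_system X) {FF : Filter F} (f g : X -> \bar R) (l : R) :
  (forall e, 0 < e -> \forall x \near F, ((l - e)%:E + g x <= f x)%E) ->
  (l%:E + limf_einf g F <= limf_einf f F)%E.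
Proof.
move=> fg; rewrite /limf_einf leeNr_shift.
apply: limf_esup_le_shift => e e0; near=> x.
rewrite leeNl_shift opprD opprK.
by near: x; exact: fg.
Unshelve. all: by end_near. Qed.

Lemma lne_le (R : realType) (x y : \bar R) : (x <= y)%E -> (lne x <= lne y)%E.
Proof.
move=> xy; have [x0|x0] := leP x 0%E; first by rewrite le0_lneNy ?leNye.
by rewrite lee_lne// in_itv/= leey andbT ltW// (lt_le_trans x0).
Qed.

(** At [x = 0] both sides are -oo, so separation numbers need no positivity check. *)
Lemma lneM_EFin (R : realType) (r : R) (x : \bar R) :
  0 < r -> (0 <= x)%E -> lne (r%:E * x)%E = ((ln r)%:E + lne x)%E.
Proof.
move=> r0; rewrite le_eqVlt => /orP[/eqP <-|x0].
  by rewrite mule0 /= lexx addeNy.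
by rewrite lneM ?lne_EFin// in_itv/= ?leey ?x0 ?lte_fin ?r0.
Qed.

Lemma divD_EFin (R : realType) (a r : R) (x : \bar R) :
  0 < r -> ((a%:E + x) / r%:E = (a / r)%:E + x / r%:E)%E.
Proof.
move=> r0; rewrite inver gt_eqF// muleDl//.
Qed.

(** * Separated sets as injective finite families *)

Section SeparatedFamilies.
Context {R : realType} (S : dynsys R).
Implicit Types (n : nat) (K : set (ambient S)) (delta : R).

(** The maximum in [bowen_dist] starts from 0; for nonnegative [delta] this default cannot exceed
    [delta], so an actual time does. *)
Lemma bowen_gtP n (delta : R) (w z : ambient S) : 0 <= delta ->
  reflect (exists2 k : 'I_n, true &
             delta < tdist (iter k (@tmap R S) w) (iter k (@tmap R S) z))
          (delta < bowen_dist n w z).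
Proof.
move=> d0; apply: (iffP (bigmax_gtP _ _ _ _)) => [[|//]|]; last by right.
by rewrite ltNge d0.
Qed.

(** Together with [sep_number_le] this replaces sets and cardinal equality by families indexed by
    finite types, where counting is direct. *)
Lemma sep_number_ge n K delta (I : finType) (f : I -> ambient S) :
  injective f -> (forall i, K (f i)) ->
  (forall i j, i <> j -> delta < bowen_dist n (f i) (f j)) ->
  (#|I|%:R%:E <= sep_number n K delta)%E.
Proof.
move=> finj fK fsep; apply: ereal_sup_ubound; exists #|I| => //.
exists (range f); split.
- by move=> _ [i _ <-].
- apply: (card_eq_trans (inj_card_eq _)); first by move=> i j _ _ /finj.
  have -> : `I_#|I| = (fun i : I => nat_of_ord (enum_rank i)) @` [set: I].
    apply/seteqP; split=> [k /= kI|_ [i _ <-]]; last exact: ltn_ord.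
    by exists (enum_val (Ordinal kI)) => //; rewrite enum_valK.
  rewrite card_eq_sym; apply: inj_card_eq => i j _ _ /val_inj.
  exact: enum_rank_inj.
- by move=> _ _ [i _ <-] [j _ <-] ij; apply: fsep => /(congr1 f).
Qed.

Lemma sep_number_le n K delta (x : \bar R) :
  (forall m (f : 'I_m -> ambient S), injective f -> (forall i, K (f i)) ->
    (forall i j, i <> j -> delta < bowen_dist n (f i) (f j)) ->
    (m%:R%:E <= x)%E) ->
  (sep_number n K delta <= x)%E.
Proof.
move=> Kx; apply: ge_ereal_sup => _ [m [H [HK Hm Hsep]] <-].
move: Hm; rewrite card_eq_sym => /card_eqP[g].
have gP (i : 'I_m) : nat_of_ord i \in `I_m by rewrite inE /= ltn_ord.
pose f (i : 'I_m) : ambient S := set_val (g (SigSub (gP i))).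
have finj : injective f.
  move=> i j /val_inj gij; have := @inj _ _ _ g.
  move=> /(_ (SigSub (gP i)) (SigSub (gP j))).
  by rewrite !in_setT => /(_ isT isT gij) [] /val_inj.
have Hf i : H (f i) by apply/set_mem; rewrite /f; case: (g _).
apply: (Kx m f) => // [i|i j ij]; first exact: HK.
by apply: Hsep => // /finj.
Qed.

(** Witnessed by the empty family. *)
Lemma sep_number_ge0 n K delta : (0 <= sep_number n K delta)%E.
Proof.
have h0 (v : void) : False by case: v.
have := @sep_number_ge n K delta void (fun v => match v with end).
by rewrite card_void; apply => v; case: (h0 v).
Qed.

End SeparatedFamilies.

(** * Separation numbers of product sets *)

Section ProductSystem.
Context {R : realType} (S1 S2 : dynsys R).
Local Notation S := (prod_sys S1 S2).
Implicit Types (n : nat) (delta : R).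

Lemma iter_prod_sys k (p : ambient S) :
  iter k (@tmap R S) p =
  (iter k (@tmap R S1) p.1, iter k (@tmap R S2) p.2).
Proof. by elim: k => [|k /= ->]//; case: p. Qed.

Lemma bowen_dist_prod n (p q : ambient S) :
  bowen_dist n p q = Num.max (bowen_dist n p.1 q.1) (bowen_dist n p.2 q.2).
Proof.
by rewrite /bowen_dist -bigmax_split; apply: eq_bigr => k _; rewrite !iter_prod_sys.
Qed.

(** Distinct pairs differ in one factor and are separated there, and the Bowen distance of the
    product is the maximum of the two. *)
Lemma sep_number_prod_ge n (K : set (ambient S1)) (L : set (ambient S2))
    delta (I : finType) (f : I -> ambient S1) :
  injective f -> (forall i, K (f i)) ->
  (forall i j, i <> j -> delta < bowen_dist n (f i) (f j)) -> (0 < #|I|)%N ->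
  (#|I|%:R%:E * sep_number n L delta <=
   @sep_number R S n (K `*` L) delta)%E.
Proof.
(* After division the separation number of [L] stands alone on the left and can be tested one finite
   family at a time, even if it is infinite. *)
move=> finj fK fsep I0; rewrite -lee_pdivlMl ?ltr0n//.
apply: sep_number_le => m g ginj gL gsep.
rewrite lee_pdivlMl ?ltr0n// -EFinM -natrM -[in X in (_ * X)%N](card_ord m) -card_prod.
apply: (@sep_number_ge R S _ _ _ _ (fun p => (f p.1, g p.2))).
- by move=> [i j] [i' j'] /= [] /finj -> /ginj ->.
- by move=> [i j]; split; [exact: fK|exact: gL].
move=> [i j] [i' j'] /= ij; rewrite bowen_dist_prod lt_max /=.
have [ii|/eqP ii] := eqVneq i i'; last by rewrite fsep.
by rewrite gsep ?orbT// => jj; apply: ij; rewrite ii jj.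
Qed.

(* A coloring whose classes have diameter at most delta splits a separated set
   of the product into pieces whose second projections are separated. *)
Lemma sep_number_prod_le n (K : set (ambient S1)) (L : set (ambient S2))
    delta (J : finType) (col : ambient S1 -> J) :
  (forall y : ambient S2, tdist y y <= delta) -> 0 <= delta ->
  (forall w z, K w -> K z -> col w = col z -> bowen_dist n w z <= delta) ->
  (@sep_number R S n (K `*` L) delta <=
   #|J|%:R%:E * sep_number n L delta)%E.
Proof.
move=> refl d0 colP; apply: sep_number_le => m f finj fKL fsep.
have fib (c : J) : (#|{: {i : 'I_m | col (f i).1 == c}}|%:R%:E
    <= sep_number n L delta)%E.
  have snd_sep (i j : {i : 'I_m | col (f i).1 == c}) : i <> j ->
      delta < bowen_dist n (f (val i)).2 (f (val j)).2.
    move=> ij; have := fsep (val i) (val j) (fun e => ij (val_inj e)).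
    rewrite bowen_dist_prod lt_max ltNge colP//; [exact: (fKL _).1..|].
    by rewrite (eqP (valP i)) (eqP (valP j)).
  apply: (@sep_number_ge R S2 _ _ _ _ (fun i => (f (val i)).2)) => // [i j e|i].
    (* Equal second projections would have a point farther than [delta] from itself at some time. *)
    apply/eqP/contraT => /eqP/snd_sep; rewrite e => /(bowen_gtP _ _ _ _ _ d0)[k _].
    by rewrite ltNge refl.
  exact: (fKL _).2.
have -> : m = (\sum_(c : J) #|{: {i : 'I_m | col (f i).1 == c}}|)%N.
  rewrite -[LHS]card_ord -sum1_card (partition_big (fun i => col (f i).1) xpredT)//=.
  by apply: eq_bigr => c _; rewrite card_sig -sum1_card; apply: eq_bigl => i; rewrite !inE.
rewrite natr_sum -sumEFin.
rewrite mule_natl.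
have -> : (sep_number n L delta *+ #|J| = \sum_(c : J) sep_number n L delta)%E.
  by rewrite sumr_const.
by apply: lee_sum => c _; exact: fib.
Qed.

End ProductSystem.

(** * Exponential growth rates of products *)

(** The set may vary with [n]: constant families give [htop], and the preimages of a stable set give
    [preimage_entropy]. *)
Definition growth {R : realType} (S : dynsys R) (K : nat -> set (ambient S))
    (delta : R) : \bar R :=
  limn_esup (fun n => (lne (sep_number n (K n) delta) / n%:R%:E)%E).

Lemma near_divn_lt (R : realType) (u e : R) : 0 < e ->
  \forall n \near \oo, (0 < n)%N /\ u / n%:R < e.
Proof.
move=> e0; near=> n.
have n0 : (0 < n)%N by near: n; exact: nbhs_infty_gt.
split=> //; rewrite ltr_pdivrMr ?ltr0n// -ltr_pdivrMl// mulrC.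
by near: n; exact: nbhs_infty_gtr.
Unshelve. all: by end_near. Qed.

Section Growth.
Context {R : realType} (S1 S2 : dynsys R).
Variables (K : nat -> set (ambient S1)) (L : nat -> set (ambient S2)) (delta : R).

(** The [k] extra positions cost [k * ln M.+1 / n], which vanishes in the limit. *)
Lemma growth_prod_le (M k : nat) :
  (forall n, (@sep_number R (prod_sys S1 S2) n (K n `*` L n) delta
              <= (M.+1 ^ (n + k))%:R%:E * sep_number n (L n) delta)%E) ->
  (growth (prod_sys S1 S2) (fun n => K n `*` L n) delta
   <= (ln M.+1%:R)%:E + growth S2 L delta)%E.
Proof.
move=> KL; apply: limf_esup_le_shift => e e0; near=> n.
have [n0 ne] : (0 < n)%N /\ (k%:R * ln M.+1%:R : R) / n%:R < e.
  by near: n; exact: near_divn_lt.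
have n0R : 0 < n%:R :> R by rewrite ltr0n.
apply: (@le_trans _ _ ((ln (M.+1 ^ (n + k))%:R / n%:R)%:E
                       + lne (sep_number n (L n) delta) / n%:R%:E)%E).
  rewrite -divD_EFin// -lneM_EFin ?ltr0n ?expn_gt0 ?sep_number_ge0//.
  rewrite inver gt_eqF// lee_pmul2r ?lte_fin ?invr_gt0//.
  exact: lne_le (KL n).
rewrite leeD2r// lee_fin natrX lnXn ?ltr0n//.
rewrite -[X in X / _]mulr_natl natrD mulrDl mulrDl.
by rewrite mulrAC divff ?gt_eqF// mul1r lerD2l ltW.
Unshelve. all: by end_near. Qed.

(** [D n] counts free positions below [n] when one residue class mod [P] is blocked; the blocked
    class costs the proportion [1 / P], and the additive 1 disappears after division by [n]. *)
Lemma growth_prod_ge (N P : nat) (D : nat -> nat) :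
  (0 < N)%N -> (0 < P)%N -> (forall n, (n <= D n + n %/ P + 1)%N) ->
  (forall n, ((N ^ D n)%:R%:E * sep_number n (L n) delta
              <= @sep_number R (prod_sys S1 S2) n (K n `*` L n) delta)%E) ->
  (((1 - P%:R^-1) * ln N%:R)%:E + growth S2 L delta
   <= growth (prod_sys S1 S2) (fun n => K n `*` L n) delta)%E.
Proof.
move=> N0 P0 Dn KL; apply: limf_esup_ge_shift => e e0; near=> n.
have [n0 ne] : (0 < n)%N /\ (ln N%:R : R) / n%:R < e.
  by near: n; exact: near_divn_lt.
have n0R : 0 < n%:R :> R by rewrite ltr0n.
have P0R : 0 < P%:R :> R by rewrite ltr0n.
apply: (@le_trans _ _ ((ln (N ^ D n)%:R / n%:R)%:E
                       + lne (sep_number n (L n) delta) / n%:R%:E)%E); last first.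
  rewrite -divD_EFin// -lneM_EFin ?ltr0n ?expn_gt0 ?N0 ?sep_number_ge0//.
  rewrite inver gt_eqF// lee_pmul2r ?lte_fin ?invr_gt0//.
  exact: lne_le (KL n).
rewrite leeD2r// lee_fin natrX lnXn ?ltr0n//.
rewrite -[X in X / _]mulr_natl mulrAC.
have lnN : 0 <= ln N%:R :> R by rewrite ln_ge0// ler1n.
have DR : n%:R - n%:R / P%:R - 1 <= (D n)%:R :> R.
  rewrite !lerBlDr; apply: (@le_trans _ _ ((D n)%:R + 1%:R + (n %/ P)%:R)).
    by rewrite -!natrD ler_nat; have := Dn n; lia.
  rewrite lerD2l ler_pdivlMr// -natrM ler_nat; exact: leq_divM.
have : (n%:R - n%:R / P%:R - 1) / n%:R * ln N%:R <= (D n)%:R / n%:R * ln N%:R :> R.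
  by rewrite ler_wpM2r// ler_wpM2r// invr_ge0 ltW.
apply: le_trans.
have -> : (n%:R - n%:R / P%:R - 1) / n%:R * ln N%:R
    = (1 - P%:R^-1) * ln N%:R - ln N%:R / n%:R :> R.
  by field; rewrite !gt_eqF.
by rewrite lerD2l lerN2 ltW.
Unshelve. all: by end_near. Qed.

End Growth.

(** * Weighted supremum distances on sequences *)

Section SequenceDistances.
Context {R : realType}.

(** A set without a real supremum has [sup] equal to 0, so boundedness need not be assumed. *)
Lemma seq_dist_ge0 (A : Type) (d0 : A -> A -> R) (x y : int -> A) :
  (forall s t, 0 <= d0 s t) -> 0 <= seq_dist d0 x y.
Proof.
move=> d00; rewrite /seq_dist; set B := [set _ | _ in _].
have [bB|/sup_out ->//] := pselect (has_sup B).
have : B (d0 (x 0) (y 0) / 2 ^+ `|0 : int|%N) by exists 0.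
by move=> /(ub_le_sup bB.2); apply: le_trans; rewrite divr_ge0// exprn_ge0.
Qed.

Lemma seq_dist_le (A : Type) (d0 : A -> A -> R) (x y : int -> A) (delta : R) :
  (forall i, d0 (x i) (y i) / 2 ^+ `|i|%N <= delta) -> seq_dist d0 x y <= delta.
Proof.
move=> xy; apply: ge_sup; last by move=> _ [i _ <-].
by exists (d0 (x 0) (y 0) / 2 ^+ `|0 : int|%N); exists 0.
Qed.

Lemma seq_distxx (A : Type) (d0 : A -> A -> R) (x : int -> A) :
  (forall s t, 0 <= d0 s t) -> (forall s, d0 s s = 0) -> seq_dist d0 x x = 0.
Proof.
move=> d00 d0xx; apply/eqP; rewrite eq_le seq_dist_ge0// andbT.
by apply: seq_dist_le => i; rewrite d0xx mul0r.
Qed.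

Lemma coord_dist_ge0 (x y : int -> R) : 0 <= coord_dist x y.
Proof. exact: seq_dist_ge0. Qed.

Lemma coord_distxx (x : int -> R) : coord_dist x x = 0.
Proof. by apply: seq_distxx => // s; rewrite subrr normr0. Qed.

Lemma rhoxx (y : int -> int -> R) : rho y y = 0.
Proof. exact: seq_distxx coord_dist_ge0 coord_distxx. Qed.

(** The uniform bound [b] makes the supremum genuine, hence an upper bound of each weighted term. *)
Lemma le_coord_dist (x y : int -> R) (b : R) (i : int) :
  (forall j, `|x j - y j| <= b) -> `|x i - y i| / 2 ^+ `|i|%N <= coord_dist x y.
Proof.
move=> xyb; apply: ub_le_sup; last by exists i.
exists b => _ [j _ <-]; rewrite ler_pdivrMr ?exprn_gt0//.
apply: (le_trans (xyb j)); rewrite ler_peMr//.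
  exact: le_trans (xyb 0).
by rewrite exprn_ege1// ler1n.
Qed.

Lemma iter_zshift1 (A : Type) (k : nat) (x : int -> A) :
  iter k (zshift 1) x = zshift k%:Z x.
Proof.
elim: k => [|k /= ->]; apply/funext => j; rewrite /zshift ?addr0//.
by congr x; lia.
Qed.

End SequenceDistances.

(** * Normalisation by [ln delta^-1] *)

Lemma le_div_shift (R : realType) (c l : R) (x y : \bar R) : 0 < l ->
  (x <= (c * l)%:E + y)%E -> (x / l%:E <= c%:E + y / l%:E)%E.
Proof.
move=> l0 xy; rewrite -[c](@mulfK _ l) ?gt_eqF// -divD_EFin//.
by rewrite !inver gt_eqF// lee_pmul2r ?lte_fin ?invr_gt0.
Qed.

Lemma ge_div_shift (R : realType) (c l : R) (x y : \bar R) : 0 < l ->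
  ((c * l)%:E + y <= x)%E -> (c%:E + y / l%:E <= x / l%:E)%E.
Proof.
move=> l0 xy; rewrite -[c](@mulfK _ l) ?gt_eqF// -divD_EFin//.
by rewrite !inver gt_eqF// lee_pmul2r ?lte_fin ?invr_gt0.
Qed.

Lemma near0_lnV_gt (R : realType) (b : R) :
  \forall delta \near 0^'+, 0 < delta /\ b < ln delta^-1.
Proof.
near=> d; have d0 : 0 < d by near: d; exact: nbhs_right_gt.
split=> //; rewrite -ltr_expR lnK ?posrE ?invr_gt0//.
rewrite -[expR b]invrK ltf_pV2 ?posrE ?invr_gt0 ?expR_gt0//.
by near: d; apply: nbhs_right_lt; rewrite invr_gt0 expR_gt0.
Unshelve. all: by end_near. Qed.

(** * From bounds on entropies to the four dimensions *)

Section DimensionsOfProduct.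
Context {R : realType} (S1 S2 : dynsys R).
Local Notation S := (prod_sys S1 S2).
Variables (q : ambient S -> R -> \bar R) (q2 : ambient S2 -> R -> \bar R).
Local Notation W1 := (@phase R S1).
Local Notation W2 := (@phase R S2).

Hypothesis nonempty1 : exists x, W1 x.
Hypothesis q_ge : forall x y delta, W1 x -> 0 < delta ->
  (q2 y delta <= q (x, y) delta)%E.
(** Here the threshold for [delta] may depend on [x], whereas in [q_le_uniform] it may not. This is
    the difference between a supremum taken after the limit, which gains nothing, and one taken
    before it, which gains 1. *)
Hypothesis q_le_pointwise : forall x, W1 x -> forall e, 0 < e ->
  \forall delta \near 0^'+, forall y,
    (q (x, y) delta <= (e * ln delta^-1)%:E + q2 y delta)%E.
Hypothesis q_le_uniform : forall e, 0 < e ->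
  \forall delta \near 0^'+, forall x y, W1 x ->
    (q (x, y) delta <= ((1 + e) * ln delta^-1)%:E + q2 y delta)%E.
Hypothesis q_ge_some : forall e, 0 < e ->
  \forall delta \near 0^'+, exists2 x, W1 x & forall y,
    (((1 - e) * ln delta^-1)%:E + q2 y delta <= q (x, y) delta)%E.

Let sup_le e : 0 < e -> \forall delta \near 0^'+,
  (ereal_sup [set rate q w delta | w in @phase R S]
   <= (1 + e)%:E + ereal_sup [set rate q2 y delta | y in W2])%E.
Proof.
move=> e0; near=> d.
have [d0 ld0] : 0 < d /\ 0 < ln d^-1 by near: d; exact: near0_lnV_gt.
apply: ge_ereal_sup => _ [[x y] [/= Wx Wy] <-].
apply: (@le_trans _ _ ((1 + e)%:E + rate q2 y d)%E).
  apply: le_div_shift => //; move: x y Wx {Wy}.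
  by near: d; apply: filterS (q_le_uniform e e0) => d + x y Wx; exact.
by rewrite leeD2l//; apply: ereal_sup_ubound; exists y.
Unshelve. all: by end_near. Qed.

(** The point of the first factor may change with [delta], because the supremum over points is taken
    before the limit. *)
Let sup_ge e : 0 < e -> \forall delta \near 0^'+,
  ((1 - e)%:E + ereal_sup [set rate q2 y delta | y in W2]
   <= ereal_sup [set rate q w delta | w in @phase R S])%E.
Proof.
move=> e0; near=> d.
have [d0 ld0] : 0 < d /\ 0 < ln d^-1 by near: d; exact: near0_lnV_gt.
have [x Wx xq] : exists2 x, W1 x & forall y,
    (((1 - e) * ln d^-1)%:E + q2 y d <= q (x, y) d)%E.
  by near: d; exact: q_ge_some.
rewrite -leeBrDl//; apply: ge_ereal_sup => _ [y Wy <-]; rewrite leeBrDl//.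
apply: (@le_trans _ _ (rate q (x, y) d)); first exact: ge_div_shift (xq y).
by apply: ereal_sup_ubound; exists (x, y).
Unshelve. all: by end_near. Qed.

Lemma limsup_sup_prod : limsup_sup q = (1%:E + limsup_sup q2)%E.
Proof.
by apply/eqP; rewrite eq_le limf_esup_le_shift ?limf_esup_ge_shift.
Qed.

Lemma liminf_sup_prod : liminf_sup q = (1%:E + liminf_sup q2)%E.
Proof.
by apply/eqP; rewrite eq_le limf_einf_le_shift ?limf_einf_ge_shift.
Qed.

Let rate_le x : W1 x -> forall y e, 0 < e ->
  \forall delta \near 0^'+, (rate q (x, y) delta <= (0 + e)%:E + rate q2 y delta)%E.
Proof.
move=> Wx y e e0; near=> d.
have [d0 ld0] : 0 < d /\ 0 < ln d^-1 by near: d; exact: near0_lnV_gt.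
apply: le_div_shift => //; rewrite add0r; move: y.
by near: d; exact: q_le_pointwise.
Unshelve. all: by end_near. Qed.

Let rate_ge x : W1 x -> forall y e, 0 < e ->
  \forall delta \near 0^'+, ((0 - e)%:E + rate q2 y delta <= rate q (x, y) delta)%E.
Proof.
move=> Wx y e e0; near=> d.
have [d0 ld0] : 0 < d /\ 0 < ln d^-1 by near: d; exact: near0_lnV_gt.
apply: ge_div_shift => //; apply: le_trans (q_ge x y d Wx d0).
by rewrite geeDr// lee_fin sub0r nmulr_rle0 ?oppr_lt0// ltW.
Unshelve. all: by end_near. Qed.

Let sup_prodE (f : ambient S -> \bar R) (g : ambient S2 -> \bar R) :
  (forall x y, W1 x -> f (x, y) = g y) ->
  [set f w | w in @phase R S] = [set g y | y in W2].
Proof.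
move=> fg; apply/seteqP; split=> [_ [[x y] [/= Wx Wy] <-]|_ [y Wy <-]].
  by exists y => //; rewrite fg.
by have [x Wx] := nonempty1; exists (x, y) => //; rewrite fg.
Qed.

Lemma sup_limsup_prod : sup_limsup q = sup_limsup q2.
Proof.
congr ereal_sup; apply: sup_prodE => x y Wx; rewrite -[RHS]add0e.
apply/eqP; rewrite eq_le limf_esup_le_shift ?limf_esup_ge_shift//.
- exact: rate_ge.
- exact: rate_le.
Qed.

Lemma sup_liminf_prod : sup_liminf q = sup_liminf q2.
Proof.
congr ereal_sup; apply: sup_prodE => x y Wx; rewrite -[RHS]add0e.
apply/eqP; rewrite eq_le limf_einf_le_shift ?limf_einf_ge_shift//.
- exact: rate_ge.
- exact: rate_le.
Qed.

End DimensionsOfProduct.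

(** * The pieces of X and the positions of the symbol 2 *)

Section SpaceX.
Context {R : realType} (P : nat -> nat).
Hypothesis P_gt0 : forall m, (1 <= m)%N -> (1 <= P m)%N.
Hypothesis P_incr : forall m n, (1 <= m)%N -> (m < n)%N -> (P m < P n)%N.

(** A single index for all pieces, so that lying in the same piece becomes an equality of natural
    numbers. *)
Definition X_part (n : nat) : set (int -> R) :=
  if n == 0%N then X_zero else X_pos P n.

Lemma X_spaceP (x : int -> R) : X_space P x <-> exists n, X_part n x.
Proof.
split=> [[x0|[n /= n1 xn]]|[n]]; first by exists 0%N.
  by exists n; rewrite /X_part gtn_eqF.
rewrite /X_part; case: eqP => [_ x0|/eqP n0 xn]; first by left.
by right; exists n => //=; rewrite lt0n.
Qed.

Lemma zshift_X_part (n : nat) (t : int) (x : int -> R) :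
  X_part n (zshift t x) <-> X_part n x.
Proof.
have imp t' (y : int -> R) : X_part n y -> X_part n (zshift t' y).
  rewrite /X_part; case: eqP => _ [].
  - by move=> y0; left=> i; exact: y0.
  - move=> [i [yi yj]]; right; exists (i - t'); split.
      by rewrite /zshift subrK.
    by move=> j ji; apply: yj => jt; apply: ji; rewrite -jt addrK.
  - move=> s _ [u Xu <-]; exists (t' + s) => //; exists u => //.
    by apply/funext => i; rewrite /zshift addrA.
split; last exact: imp.
move=> /(imp (- t)); suff -> : zshift (- t) (zshift t x) = x by [].
by apply/funext => i; rewrite /zshift subrK.
Qed.

(** From [k <= 2^(n^2 - n)] follows [k * 2^-n^2 <= 2^-n]. In particular [G n] has diameter at most
    [2^-n]. *)
Lemma G_bounds (n : nat) (s : R) : (1 <= n)%N -> G n s -> 2 ^- n <= s <= 2 * 2 ^- n.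
Proof.
move=> n1 [k /= /andP[k1 kn] <-].
have nn : (n <= n ^ 2)%N by rewrite -mulnn leq_pmulr.
rewrite lerDl mulr_ge0 ?invr_ge0 ?exprn_ge0//=.
rewrite [leRHS]mulr_natl [leRHS]mulr2n lerD2l ler_pdivrMr ?exprn_gt0//.
by rewrite mulrC -expfB_cond ?pnatr_eq0// -natrX ler_nat.
Qed.

Lemma G_in01 (n : nat) (s : R) : (1 <= n)%N -> G n s -> 0 <= s <= 1.
Proof.
move=> n1 /(G_bounds _ _ n1)/andP[sl su]; rewrite (le_trans _ sl) ?invr_ge0 ?exprn_ge0//=.
by rewrite (le_trans su)// ler_pdivrMr ?exprn_gt0// mul1r -{1}[2]expr1 ler_weXn2l// ler1n.
Qed.

Lemma X_posP (n : nat) (x : int -> R) : (1 <= n)%N -> X_pos P n x ->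
  exists t : int, forall i,
    ((P n)%:Z %| i + t)%Z /\ x i = 2 \/ ~~ ((P n)%:Z %| i + t)%Z /\ G n (x i).
Proof.
move=> n1 [t _ [u Xu <-]]; exists t => i; have [u2 uG] := Xu (i + t).
have [d|nd] := boolP (_ %| _)%Z; [left|right]; split=> //.
  by apply: u2; apply/eqP; rewrite eqz_mod_dvd subr0.
by apply: uG => /eqP; rewrite eqz_mod_dvd subr0 (negbTE nd).
Qed.

(** The gap between 1 and 2 makes the places of the 2s visible to any comparison finer than 1. *)
Lemma X_part_val (n : nat) (x : int -> R) i : X_part n x -> x i = 2 \/ 0 <= x i <= 1.
Proof.
rewrite /X_part; case: eqP => [_ [x0|[j [xj x0]]]|/eqP].
- by right; rewrite x0 lexx ler01.
- have [->|/eqP ij] := eqVneq i j; first by left.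
  by right; rewrite x0// lexx ler01.
rewrite -lt0n => n0 /(X_posP _ _ n0)[t /(_ i)[[_ ->]|[_ /(G_in01 _ _ n0)]]];
by [left|right].
Qed.

Lemma X_part_itv (n : nat) (x : int -> R) i : X_part n x -> 0 <= x i <= 2.
Proof.
by move=> /(X_part_val n x i)[->|/andP[? ?]]; lra.
Qed.

(** Both 0 and 2 are listed for every [n], so that one formula also covers the piece of index 0. *)
Definition alphabet (n : nat) : seq R :=
  [:: 0; 2] ++ [seq 2 ^- n + k%:R * 2 ^- (n ^ 2)%N | k <- iota 1 (2 ^ (n ^ 2 - n))].

Lemma X_part_alphabet (n : nat) (x : int -> R) i : X_part n x -> x i \in alphabet n.
Proof.
rewrite /X_part /alphabet !inE; case: eqP => [_ [->|[j [xj x0]]]|/eqP].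
- by rewrite eqxx.
- have [->|/eqP ij] := eqVneq i j; first by rewrite xj eqxx orbT.
  by rewrite x0// eqxx.
rewrite -lt0n => n0 /(X_posP _ _ n0)[t /(_ i)[[_ ->]|[_ [k /= kn <-]]]].
  by rewrite eqxx orbT.
by apply/orP; right; apply/orP; right; apply: map_f; rewrite mem_iota add1n ltnS.
Qed.

Lemma X_pos_two (n : nat) (x : int -> R) : (1 <= n)%N -> X_pos P n x ->
  exists t : int, forall i, x i = 2 <-> ((P n)%:Z %| i + t)%Z.
Proof.
move=> n1 /(X_posP _ _ n1)[t xt]; exists t => i.
case: (xt i) => [[-> ->]//|[/negbTE -> /(G_in01 _ _ n1)/andP[_ x1]]].
by split=> // x2; move: x1; rewrite x2; lra.
Qed.

Lemma dvdz_beyond (p : nat) (t J : int) : (1 <= p)%N ->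
  exists2 j : int, J <= j & (p%:Z %| j + t)%Z.
Proof.
(* As [p >= 1], the multiple is at least [|J| + |t|], which is enough after subtracting [t]. *)
move=> p1; exists ((`|J| + `|t|) * p%:Z - t); last by rewrite subrK dvdz_mull.
nia.
Qed.

(* Beyond J two such points carry the symbol 2 at the same places, since any
   other symbol is at most 1; a common progression of 2s determines n. *)
Lemma X_part_matching (n m : nat) (x z : int -> R) (J : int) :
  X_part n x -> X_part m z -> (forall j, J <= j -> `|z j - x j| < 1) -> m = n.
Proof.
move=> Xx Xz zx.
have zx2 j : J <= j -> (z j = 2 <-> x j = 2).
  move=> /zx; have := X_part_val _ _ j Xx; have := X_part_val _ _ j Xz.
  by case=> [->|/andP[? ?]]; case=> [->|/andP[? ?]]; rewrite ltr_norml => /andP[? ?];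
    split=> //; lra.
have two_zero (y : int -> R) i j : X_zero y -> y i = 2 -> y j = 2 -> i = j.
  case=> [y0|[k [yk y0]]]; first by rewrite y0 => /eqP; rewrite eq_sym pnatr_eq0.
  have yk0 l : y l = 2 -> l = k.
    by move=> yl; apply: contrapT => /y0; rewrite yl => /eqP; rewrite pnatr_eq0.
  by move=> /yk0 -> /yk0 ->.
(* A progression has two 2s beyond [J], at distance [P p], while a point of [X_zero] carries at most
   one. *)
have dvd0 (u : int -> R) (p : nat) (y : int -> R) : (1 <= p)%N ->
    X_zero u -> X_pos P p y -> (forall j, J <= j -> (u j = 2 <-> y j = 2)) -> False.
  move=> p1 u0 /(X_pos_two _ _ p1)[t yt] uy.
  have Pp := P_gt0 _ p1.
  have [j Jj dj] := dvdz_beyond _ t J Pp.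
  have : j = j + (P p)%:Z.
    apply: (two_zero u) => //; first exact/uy/yt.
    by apply/uy/yt; [lia|rewrite addrAC rpredD].
  by lia.
(* Two consecutive 2s of [u] beyond [J] are also 2s of [y], so their difference [P p] is a multiple
   of [P r]. *)
have dvdP (p r : nat) (u y : int -> R) : (1 <= p)%N -> (1 <= r)%N ->
    X_pos P p u -> X_pos P r y -> (forall j, J <= j -> (u j = 2 <-> y j = 2)) ->
    (P r %| P p)%N.
  move=> p1 r1 /(X_pos_two _ _ p1)[t ut] /(X_pos_two _ _ r1)[s ys] uy.
  have [j Jj dj] := dvdz_beyond _ t J (P_gt0 _ p1).
  have d1 : ((P r)%:Z %| j + s)%Z by exact/ys/uy/ut.
  have d2 : ((P r)%:Z %| j + (P p)%:Z + s)%Z.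
    by apply/ys/uy/ut; [lia|rewrite addrAC rpredD].
  by have := rpredB d2 d1; rewrite (_ : _ - _ = (P p)%:Z)//; lia.
have xz2 j : J <= j -> (x j = 2 <-> z j = 2) by move=> /zx2 zxj; exact: iff_sym.
move: Xx Xz; rewrite /X_part.
have [->|n0] := posnP n; have [->|m0] := posnP m => //.
- by move=> Xx Xz; case: (dvd0 x m z m0 Xx Xz).
- by move=> Xx Xz; case: (dvd0 z n x n0 Xz Xx zx2).
move=> Xx Xz.
have zxP : P m = P n.
  by apply/eqP; rewrite eqn_dvd (dvdP n m x z)// (dvdP m n z x).
by case: (ltngtP m n) => // [/(P_incr _ _ m0)|/(P_incr _ _ n0)]; rewrite zxP ltnn.
Qed.

End SpaceX.

(** * Entropy bounds for families of words in X *)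

(** On a residue class the quotient by [p] is injective, and below [n] it takes at most [n %/ p + 1]
    values. *)
Lemma card_notin_progression (n p s : nat) : (0 < p)%N ->
  (n <= #|{: {j : 'I_n | (j %% p != s)%N}}| + n %/ p + 1)%N.
Proof.
move=> p0; rewrite card_sig.
rewrite -[leqLHS]card_ord -(cardC [pred j : 'I_n | (j %% p != s)%N]) -addnA leq_add2l.
pose g (j : 'I_n) : 'I_(n %/ p).+1 := inord (j %/ p).
have gE (j : 'I_n) : g j = (j %/ p)%N :> nat.
  by rewrite inordK// ltnS leq_div2r// ltnW.
have ginj : {in [predC [pred j : 'I_n | (j %% p != s)%N]] &, injective g}.
  move=> i j; rewrite !inE !negbK => /eqP is_ /eqP js.
  move=> /(congr1 (@nat_of_ord _)); rewrite !gE => ij.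
  by apply: val_inj => /=; rewrite (divn_eq i p) (divn_eq j p) is_ js ij.
rewrite -(card_in_image ginj); apply: leq_trans (max_card _) _.
by rewrite card_ord addn1.
Qed.

Section GrowthOverX.
Context {R : realType} (P : nat -> nat) (S2 : dynsys R).
Hypothesis P_gt0 : forall m, (1 <= m)%N -> (1 <= P m)%N.
Hypothesis P_incr : forall m n, (1 <= m)%N -> (m < n)%N -> (P m < P n)%N.
Hypothesis tdistxx2 : forall y : ambient S2, tdist y y = 0.
Local Notation XS := (prod_sys (X_sys P) S2).

(** The classes of the symbols at positions from [-k] to [n + k - 1] determine a point up to [delta]
    during [n] steps: a symbol farther than [k] from the origin contributes at most [2 / 2^k]. *)
Lemma sep_number_alphabet_le (n k M : nat) (K : set (int -> R)) (L : set (ambient S2))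
    (delta : R) (A : set R) (kappa : R -> 'I_M.+1) :
  0 <= delta -> 2 / 2 ^+ k <= delta -> (forall s, A s -> 0 <= s <= 2) ->
  (forall s t, A s -> A t -> kappa s = kappa t -> `|s - t| <= delta) ->
  (forall z i, K z -> A (z i)) ->
  (@sep_number R XS n (K `*` L) delta
   <= (M.+1 ^ (n + (k + k)))%:R%:E * sep_number n L delta)%E.
Proof.
move=> d0 kd A02 Akappa KA.
pose col (z : int -> R) : {ffun 'I_(n + (k + k)) -> 'I_M.+1} :=
  [ffun j : 'I_(n + (k + k)) => kappa (z (j%:Z - k%:Z))].
rewrite -[X in (X ^ _)%N]card_ord -[X in (_ ^ X)%N]card_ord -card_ffun.
apply: (@sep_number_prod_le _ (X_sys P) _ _ _ _ _ _ col) => // [y|w z Kw Kz /ffunP wz].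
  by rewrite tdistxx2.
rewrite leNgt; apply/negP => /(@bowen_gtP R (X_sys P) n _ _ _ d0)[l _].
apply/negP; rewrite -leNgt /= !iter_zshift1; apply: seq_dist_le => i.
rewrite /zshift.
have [ik|ki] := leqP `|i| k.
  rewrite ler_pdivrMr ?exprn_gt0//.
  have jP : (absz (i + l%:Z + k%:Z)%R < n + (k + k))%N by have := ltn_ord l; lia.
  have := wz (Ordinal jP); rewrite !ffunE /=.
  have -> : (absz (i + l%:Z + k%:Z)%R)%:Z - k%:Z = i + l%:Z by lia.
  move=> kwz; apply: le_trans (Akappa _ _ (KA _ _ Kw) (KA _ _ Kz) kwz) _.
  by rewrite ler_peMr// exprn_ege1// ler1n.
apply: le_trans kd; apply: (@le_trans _ _ (2 / 2 ^+ `|i|%N)).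
  rewrite ler_wpM2r// ler_norml.
  by have /A02/andP[? ?] := KA _ (i + l%:Z) Kw;
    have /A02/andP[? ?] := KA _ (i + l%:Z) Kz; lra.
by rewrite ler_wpM2l// lef_pV2 ?posrE ?exprn_gt0// ler_weXn2l ?ler1n// ltnW.
Qed.

Lemma growth_alphabet_le (M : nat) (K : nat -> set (int -> R))
    (L : nat -> set (ambient S2)) (delta : R) (A : set R) (kappa : R -> 'I_M.+1) :
  0 < delta -> (forall s, A s -> 0 <= s <= 2) ->
  (forall s t, A s -> A t -> kappa s = kappa t -> `|s - t| <= delta) ->
  (forall n z i, K n z -> A (z i)) ->
  (growth XS (fun n => K n `*` L n) delta
   <= (ln M.+1%:R)%:E + growth S2 L delta)%E.
Proof.
(* Any [k] independent of [n] with [2^k >= 2 / delta] would do; this one works because [k < 2^k]. *)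
move=> d0 A02 Akappa KA; pose k := (Num.trunc (2 / delta)).+1.
have kd : 2 / 2 ^+ k <= delta.
  rewrite ler_pdivrMr ?exprn_gt0// -ler_pdivrMl// mulrC.
  apply: (@le_trans _ _ k%:R); first exact: ltW (truncnS_gt _).
  by rewrite -natrX ler_nat ltnW// ltn_expl.
apply: (@growth_prod_le R (X_sys P) S2 K L delta M (k + k)) => n.
exact: (@sep_number_alphabet_le _ _ _ _ _ _ A kappa) (ltW d0) kd A02 Akappa (KA n).
Qed.

(** Distinct letters of [G m] are at least [2^-m^2] apart, hence more than [delta], so different
    words on the free positions are separated at a time when they differ. *)
Lemma growth_words_ge (m : nat) (s : nat -> nat) (K : nat -> set (int -> R))
    (L : nat -> set (ambient S2)) (delta : R) :
  (1 <= m)%N -> 0 <= delta -> delta < 2 ^- (m ^ 2)%N ->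
  (forall n, K n `<=` X_space P) ->
  (forall n (u : nat -> R), (forall j, G m (u j)) -> exists2 z, K n z &
     forall j, (j < n)%N -> (j %% P m)%N != s n -> z j%:Z = u j) ->
  (((1 - (P m)%:R^-1) * ln (2 ^ (m ^ 2 - m))%:R)%:E + growth S2 L delta
   <= growth XS (fun n => K n `*` L n) delta)%E.
Proof.
move=> m1 d0 dm KX Kwords; set N := (2 ^ (m ^ 2 - m))%N.
have N0 : (0 < N)%N by rewrite expn_gt0.
pose J n := {j : 'I_n | (j %% P m)%N != s n}.
apply: (@growth_prod_ge R (X_sys P) S2 K L delta N (P m) (fun n => #|{: J n}|)) => //.
- exact: P_gt0.
- by move=> n; apply: card_notin_progression; exact: P_gt0.
move=> n; rewrite -[X in (X ^ _)%N](card_ord N) -card_ffun.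
pose I := {ffun J n -> 'I_N}.
(* The default 0 outside [J n] still names a letter, so [u] below takes values in [G m] everywhere.
   The successor there matches the indices of [G], which start at 1. *)
pose num (phi : I) (j : nat) : nat :=
  if insub j is Some o then if insub o is Some p then val (phi p) else 0%N else 0%N.
have numE phi (p : J n) : num phi (val (val p)) = phi p.
  by rewrite /num !valK.
have numN phi j : (num phi j < N)%N.
  rewrite /num; case: insubP => [i _ _|] //; case: insubP => [p _ _|] //.
  exact: ltn_ord.
pose u (phi : I) (j : nat) : R := 2 ^- m + (num phi j).+1%:R * 2 ^- (m ^ 2)%N.
have uG phi j : G m (u phi j) by exists (num phi j).+1 => //=; exact: numN.
have /choice[f fP] : forall phi : I, exists z : int -> R, K n z /\
    forall j, (j < n)%N -> (j %% P m)%N != s n -> z j%:Z = u phi j.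
  by move=> phi; have [z Kz zu] := Kwords n (u phi) (uG phi); exists z; split.
have fsep (phi psi : I) : phi <> psi ->
    exists2 j : 'I_n, true & 2 ^- (m ^ 2)%N <= `|f phi j%:Z - f psi j%:Z|.
  move=> phipsi; have [p /eqP pp] : exists p, phi p != psi p.
    apply/existsP; apply: contra_notT phipsi; rewrite negb_exists => /forallP e.
    by apply/ffunP => p; apply/eqP; rewrite -[_ == _]negbK e.
  exists (val p) => //.
  rewrite !(fP _).2 ?ltn_ord ?(valP p)// /u !numE opprD addrACA subrr add0r.
  rewrite -mulrBl normrM [X in _ * X]ger0_norm ?invr_ge0 ?exprn_ge0//.
  rewrite ler_peMl ?invr_ge0 ?exprn_ge0//.
  have : (phi p : nat) <> psi p by move=> /val_inj /pp.
  move: (phi p : nat) (psi p : nat) => x y.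
  have lt_dist (v w : nat) : (v < w)%N -> 1 <= `|w.+1%:R - v.+1%:R| :> R.
    by rewrite -!natr1 -(ler_nat R) -natr1 => vw; apply: le_trans (ler_norm _); lra.
  by case: (ltngtP x y) => // /lt_dist; rewrite // distrC.
apply: (@sep_number_prod_ge R (X_sys P) S2 n _ _ delta I f) => [phi psi e|phi|phi psi /fsep[j _ jP]|].
- apply: contrapT => /fsep[j _]; rewrite e subrr normr0 leNgt.
  by rewrite invr_gt0 exprn_gt0.
- exact: (fP phi).1.
- apply/(@bowen_gtP R (X_sys P) n _ _ _ d0); exists j => //=; rewrite !iter_zshift1.
  apply: (lt_le_trans dm); apply: (le_trans jP).
  (* Coordinate 0 has weight 1, and the bound 2 comes from the symbols lying in [0,2]. *)
  have := @le_coord_dist R (zshift j%:Z (f phi)) (zshift j%:Z (f psi)) 2 0.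
  rewrite /zshift add0r expr0 divr1; apply => i.
  have /X_spaceP[a /(X_part_itv P _ _ (i + j%:Z))/andP[? ?]] := KX n _ (fP phi).1.
  have /X_spaceP[b /(X_part_itv P _ _ (i + j%:Z))/andP[? ?]] := KX n _ (fP psi).1.
  by rewrite ler_norml; lra.
- by rewrite card_ffun card_ord expn_gt0 N0.
Qed.

End GrowthOverX.

(** * Dimensions of products with X for abstract families of sets *)

Section DimensionsOverX.
Context {R : realType} (P : nat -> nat) (S2 : dynsys R).
Hypothesis P_gt0 : forall m, (1 <= m)%N -> (1 <= P m)%N.
Hypothesis P_incr : forall m n, (1 <= m)%N -> (m < n)%N -> (P m < P n)%N.
Hypothesis tdistxx2 : forall y : ambient S2, tdist y y = 0.
Variables (K : nat -> (int -> R) -> set (int -> R))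
          (L : nat -> ambient S2 -> set (ambient S2)).
Hypothesis K_part : forall p n x, X_part P p x -> K n x `<=` X_part P p.
Hypothesis K_nonempty : forall n x, X_space P x -> exists z, K n x z.
(* K n x contains all words in G_m off one residue class mod P m; the class may
   depend on n because the phase of a point of T^-n Gamma(x) does. *)
Hypothesis K_words : exists m0, forall m, (1 <= m)%N -> (m0 <= m)%N ->
  exists2 x, X_space P x & exists s : nat -> nat,
  forall n (u : nat -> R), (forall j, G m (u j)) -> exists2 z, K n x z &
    forall j, (j < n)%N -> (j %% P m)%N != s n -> z j%:Z = u j.
Local Notation XS := (prod_sys (X_sys P) S2).

Let q (w : ambient XS) : R -> \bar R := growth XS (fun n => K n w.1 `*` L n w.2).
Let q2 (y : ambient S2) : R -> \bar R := growth S2 (fun n => L n y).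

Let K_X n x : X_space P x -> K n x `<=` X_space P.
Proof.
by move=> /X_spaceP[p Xx] z /(K_part _ _ _ Xx) Xz; apply/X_spaceP; exists p.
Qed.

Let q_ge (x : int -> R) y delta : X_space P x -> 0 < delta ->
  (q2 y delta <= q (x, y) delta)%E.
Proof.
move=> Xx d0.
(* the degenerate case N = P = 1, D = 0 of the lower bound *)
have := @growth_prod_ge R (X_sys P) S2 (K ^~ x) (L ^~ y) delta 1 1 (fun=> 0%N).
rewrite ln1 mulr0 add0e; apply=> // n; first by rewrite divn1; lia.
have [z Kz] := K_nonempty n x Xx.
have := @sep_number_prod_ge R (X_sys P) S2 n (K n x) (L n y) delta unit (fun=> z).
by rewrite card_unit expn0; apply=> //; [case=> -[]|case=> -[]].
Qed.

(** All points of [K n x] use the finite alphabet of the piece of [x], whose size is fixed while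
    [ln delta^-1] tends to infinity. *)
Let q_le_pointwise (x : int -> R) : X_space P x -> forall e, 0 < e ->
  \forall delta \near 0^'+, forall y,
    (q (x, y) delta <= (e * ln delta^-1)%:E + q2 y delta)%E.
Proof.
move=> /X_spaceP[p Xx] e e0; pose M := size (@alphabet R p).
near=> d => y.
have [d0 dM] : 0 < d /\ ln M.+1%:R / e < ln d^-1 by near: d; exact: near0_lnV_gt.
pose A : set R := [set s | s \in alphabet p /\ 0 <= s <= 2].
(* Each symbol forms its own class; [M.+1] values leave room for the index of an absent symbol. *)
pose kappa (s : R) : 'I_M.+1 := inord (index s (alphabet p)).
apply: (@le_trans _ _ ((ln M.+1%:R)%:E + q2 y d)%E); last first.
  by rewrite leeD2r// lee_fin mulrC -ler_pdivrMr// ltW.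
apply: (@growth_alphabet_le R P S2 tdistxx2 M (K ^~ x) (L ^~ y) d A kappa) => //.
- by move=> s [].
- move=> s t [sA _] [tA _] /(congr1 (@nat_of_ord _)).
  rewrite !inordK ?ltnS ?index_size// => /(congr1 (nth 0 (@alphabet R p))).
  by rewrite !nth_index// => ->; rewrite subrr normr0 ltW.
move=> n z i /(K_part _ _ _ Xx) Xz.
by split; [exact: X_part_alphabet Xz|exact: X_part_itv Xz].
Unshelve. all: by end_near. Qed.

(** Cutting [0,2] into intervals of length [delta] gives at most [2 / delta + 1 <= 3 / delta]
    classes for every point at once; [ln 3] is absorbed by [e * ln delta^-1]. *)
Let q_le_uniform e : 0 < e ->
  \forall delta \near 0^'+, forall (x : int -> R) y, X_space P x ->
    (q (x, y) delta <= ((1 + e) * ln delta^-1)%:E + q2 y delta)%E.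
Proof.
move=> e0; near=> d => x y Xx.
have [d0 d3] : 0 < d /\ ln 3 / e < ln d^-1 by near: d; exact: near0_lnV_gt.
have [_ ld0] : 0 < d /\ 0 < ln d^-1 by near: d; exact: near0_lnV_gt.
have d1 : d < 1.
  by rewrite -[d]invrK invf_lt1 ?invr_gt0// -ltr_ln ?posrE ?invr_gt0// ln1.
pose M := Num.trunc (2 / d).
pose kappa (s : R) : 'I_M.+1 := inord (Num.trunc (s / d)).
apply: (@le_trans _ _ ((ln M.+1%:R)%:E + q2 y d)%E); last first.
  rewrite leeD2r// lee_fin mulrDl mul1r.
  apply: (@le_trans _ _ (ln (3 / d))).
    rewrite ler_ln ?posrE ?divr_gt0 ?ltr0n//.
    apply: (@le_trans _ _ (2 / d + 1)).
      by rewrite -natr1 lerD2r truncn_le divr_ge0// ltW.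
    by rewrite -lerBrDl -mulrBl ler_pdivlMr// mul1r; lra.
  rewrite lnM ?posrE ?invr_gt0// addrC lerD2l mulrC -ler_pdivrMr// ltW//.
apply: (@growth_alphabet_le R P S2 tdistxx2 M (K ^~ x) (L ^~ y) d
          [set s | 0 <= s <= 2] kappa) => //.
- move=> s t /= /andP[s0 s2] /andP[t0 t2] /(congr1 (@nat_of_ord _)).
  have truncM r : 0 <= r -> r <= 2 -> (Num.trunc (r / d) < M.+1)%N.
    by move=> r0 r2; rewrite ltnS le_truncn// ler_pM2r ?invr_gt0.
  rewrite !inordK ?truncM// => st.
  have := @truncn_itv _ (s / d); have := @truncn_itv _ (t / d).
  rewrite !divr_ge0 ?(ltW d0)// st => /(_ isT)/andP[tl tu] /(_ isT)/andP[sl su].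
  move: tl tu sl su; rewrite -!natr1 !ler_pdivlMr// !ltr_pdivrMr// => tl tu sl su.
  by rewrite ler_norml; lra.
- move=> n z i /(K_X _ _ Xx)/X_spaceP[p Xz]; exact: X_part_itv Xz.
Unshelve. all: by end_near. Qed.

(** Makes the proportion [1 / P m] of positions occupied by 2s at most [1 / m]. *)
Let leq_P m : (1 <= m)%N -> (m <= P m)%N.
Proof.
elim: m => [//|[_ _|m IH _]]; first exact: P_gt0.
by apply: leq_ltn_trans (IH isT) _; exact: P_incr.
Qed.

(** [m.+1] is the least [k] with [2^-k^2 <= delta]; the assumption on [m1] forces it above [m1]. *)
Let square_scale (m1 : nat) (delta : R) : 0 < delta -> delta < 2 ^- (m1 ^ 2)%N ->
  exists2 m, (m1 <= m)%N & delta < 2 ^- (m ^ 2)%N /\ 2 ^- (m.+1 ^ 2)%N <= delta.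
Proof.
move=> d0 dm1.
have exm : exists m, 2 ^- (m ^ 2)%N <= delta.
  pose k := (Num.trunc delta^-1).+1; exists k.
  rewrite -[delta]invrK lef_pV2 ?posrE ?invr_gt0 ?exprn_gt0//.
  apply: (@le_trans _ _ k%:R); first exact: ltW (truncnS_gt _).
  rewrite -natrX ler_nat; apply: leq_trans (ltnW (ltn_expl k (ltnSn 1))) _.
  by rewrite leq_exp2l// -mulnn leq_pmulr.
have [m md mmin] := ex_minnP exm.
have m1m : (m1 < m)%N.
  rewrite ltnNge; apply/negP => mm1.
  have m1m : 2 ^- (m1 ^ 2)%N <= 2 ^- (m ^ 2)%N :> R.
    rewrite lef_pV2 ?posrE ?exprn_gt0// ler_weXn2l ?ler1n// -!mulnn.
    exact: leq_mul.
  by have := lt_le_trans dm1 (le_trans m1m md); rewrite ltxx.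
exists m.-1; first by rewrite -ltnS prednK// (leq_trans _ m1m).
rewrite prednK ?(leq_trans _ m1m)//; split=> //.
by rewrite ltNge; apply/negP => /mmin; rewrite leqNgt ltn_predL (leq_trans _ m1m).
Qed.

(** At the scale given by [square_scale], words over [G m] add [(1 - 1 / P m) (m^2 - m) ln 2], which
    is at least [(m - 1)^2 ln 2], while [ln delta^-1] is at most [(m + 1)^2 ln 2]. *)
Let q_ge_some e : 0 < e ->
  \forall delta \near 0^'+, exists2 x : int -> R, X_space P x & forall y,
    (((1 - e) * ln delta^-1)%:E + q2 y delta <= q (x, y) delta)%E.
Proof.
move=> e0; have [m0 Kw] := K_words.
(* The second entry yields [e m >= 4]. Since [(m + 1)^2 - (m - 1)^2 = 4 m], this gives
   [(1 - e) (m + 1)^2 <= (m - 1)^2]. *)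
pose m1 := maxn m0 (Num.trunc (4 / e)).+1.
near=> d; have d0 : 0 < d by near: d; exact: nbhs_right_gt.
have dm1 : d < 2 ^- (m1 ^ 2)%N.
  by near: d; apply: nbhs_right_lt; rewrite invr_gt0 exprn_gt0.
have [m mm1 [dm md]] := square_scale m1 d d0 dm1.
have m_gt0 : (1 <= m)%N by apply: leq_trans mm1; rewrite leq_max orbT.
have me : 4 <= e * m%:R.
  rewrite mulrC -ler_pdivrMr//; apply: (@le_trans _ _ (Num.trunc (4 / e)).+1%:R).
    exact: ltW (truncnS_gt _).
  by rewrite ler_nat (leq_trans _ mm1)// leq_max leqnn orbT.
have [x Xx [s Kxs]] := Kw m m_gt0 (leq_trans (leq_maxl _ _) mm1).
exists x => // y.
apply: le_trans (@growth_words_ge R P S2 P_gt0 m s (K ^~ x) (L ^~ y) d m_gt0 (ltW d0)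
  dm (fun n => K_X n x Xx) Kxs).
rewrite leeD2r// lee_fin natrX lnXn// -[X in _ <= _ * X]mulr_natl.
have ln2 : 0 <= ln 2 :> R by rewrite ln_ge0// ler1n.
have lnd : 0 <= ln d^-1.
  rewrite ln_ge0// invf_ge1//; apply: (le_trans (ltW dm)).
  by rewrite invf_le1 ?exprn_gt0// exprn_ege1// ler1n.
have t1 : 1 <= m%:R :> R by rewrite ler1n.
have RHSge : (m%:R - 1) ^+ 2 * ln 2
    <= (1 - (P m)%:R^-1) * ((m ^ 2 - m)%:R * ln 2) :> R.
  have mP : (P m)%:R^-1 <= m%:R^-1 :> R.
    by rewrite lef_pV2 ?posrE ?ltr0n ?P_gt0// ler_nat leq_P.
  rewrite mulrA ler_wpM2r// natrB -?mulnn ?leq_pmulr// natrM.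
  apply: (@le_trans _ _ ((1 - m%:R^-1) * (m%:R * m%:R - m%:R))).
    by rewrite le_eqVlt; apply/orP; left; apply/eqP; field; rewrite gt_eqF ?ltr0n.
  by rewrite ler_wpM2r ?lerD2l ?lerN2//; nra.
apply: le_trans RHSge.
have lndm : ln d^-1 <= (m%:R + 1) ^+ 2 * ln 2.
  rewrite -[d^-1]invrK invrK.
  apply: (@le_trans _ _ (ln (2 ^+ (m.+1 ^ 2)%N))).
    rewrite ler_ln ?posrE ?invr_gt0 ?exprn_gt0//.
    by rewrite -[leRHS]invrK lef_pV2 ?posrE ?invr_gt0 ?exprn_gt0.
  by rewrite lnXn// -[leLHS]mulr_natl natrX -natr1.
have [e1|e1] := leP e 1.
  apply: (@le_trans _ _ ((1 - e) * ((m%:R + 1) ^+ 2 * ln 2))).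
    by rewrite ler_wpM2l// subr_ge0.
  by rewrite mulrA ler_wpM2r//; nra.
apply: (@le_trans _ _ 0); first by rewrite nmulr_rle0// subr_lt0.
by rewrite mulr_ge0// sqr_ge0.
Unshelve. all: by end_near. Qed.

Lemma dimensions_over_X :
  [/\ limsup_sup q = (1%:E + limsup_sup q2)%E,
      liminf_sup q = (1%:E + liminf_sup q2)%E,
      sup_limsup q = sup_limsup q2
    & sup_liminf q = sup_liminf q2].
Proof.
have X0 : exists x, X_space P (x : int -> R) by exists (fun=> 0); left; left.
split.
- exact: (@limsup_sup_prod R (X_sys P) S2).
- exact: (@liminf_sup_prod R (X_sys P) S2).
- exact: (@sup_limsup_prod R (X_sys P) S2).
- exact: (@sup_liminf_prod R (X_sys P) S2).
Qed.

End DimensionsOverX.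

(** * Stable, preimage and asymptotic sets of a product *)

Section ProductSets.
Context {R : realType} (S1 S2 : dynsys R).
Local Notation S := (prod_sys S1 S2).

Lemma stable_set_prod eps (w : ambient S) :
  stable_set eps w = @stable_set R S1 eps w.1 `*` @stable_set R S2 eps w.2.
Proof.
apply/seteqP; split=> [z [[W1 W2] zw]|z [[W1 zw1] [W2 zw2]]].
  by split; split=> // k; have := zw k; rewrite !iter_prod_sys /= ge_max => /andP[].
by split=> // k; rewrite !iter_prod_sys /= ge_max zw1 zw2.
Qed.

Lemma preimage_iter_prod n (K : set (ambient S1)) (L : set (ambient S2)) :
  @preimage_iter R S n (K `*` L) =
  @preimage_iter R S1 n K `*` @preimage_iter R S2 n L.
Proof.
apply/seteqP; split=> [z [[W1 W2]]|z [[W1 zK] [W2 zL]]].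
  by rewrite iter_prod_sys => -[].
by split=> //; rewrite iter_prod_sys.
Qed.

(** For nonnegative distances the maximum dominates each one and is dominated by their sum, so both
    directions follow by squeezing. *)
Lemma asymptotic_set_prod (w : ambient S) :
  (forall x y : ambient S1, 0 <= tdist x y) ->
  (forall x y : ambient S2, 0 <= tdist x y) ->
  asymptotic_set w = @asymptotic_set R S1 w.1 `*` @asymptotic_set R S2 w.2.
Proof.
move=> d1 d2; apply/seteqP; split=> [z [[W1 W2] zw]|z [[W1 zw1] [W2 zw2]]].
  by split; split=> //; apply: (squeeze_cvgr _ (cvg_cst 0) zw); apply: nearW => k;
    rewrite !iter_prod_sys /= le_max lexx ?orbT ?d1 ?d2.
split=> //; have := cvgD zw1 zw2; rewrite addr0 => zw.
apply: (squeeze_cvgr _ (cvg_cst 0) (zw _)); apply: nearW => k.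
by rewrite addrfctE !iter_prod_sys /= ge_max lerDl lerDr le_max d1 d2.
Qed.

End ProductSets.

(** * Stable and asymptotic sets in X *)

Section FamiliesInX.
Context {R : realType} (P : nat -> nat).
Hypothesis P_gt0 : forall m, (1 <= m)%N -> (1 <= P m)%N.
Hypothesis P_incr : forall m n, (1 <= m)%N -> (m < n)%N -> (P m < P n)%N.
Local Notation X := (@X_sys R P).

Lemma coord_le_tdist (x z : int -> R) (k : nat) : X_space P x -> X_space P z ->
  `|z k%:Z - x k%:Z|
  <= coord_dist (iter k (zshift 1) z) (iter k (zshift 1) x).
Proof.
move=> /X_spaceP[a Xx] /X_spaceP[b Xz]; rewrite !iter_zshift1.
have := @le_coord_dist R (zshift k%:Z z) (zshift k%:Z x) 2 0.
rewrite /zshift add0r expr0 divr1; apply => i.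
have /andP[? ?] := X_part_itv P _ _ (i + k%:Z) Xx.
have /andP[? ?] := X_part_itv P _ _ (i + k%:Z) Xz.
by rewrite ler_norml; lra.
Qed.

(** With [eps < 1] all coordinates from 0 on differ by less than 1, so [X_part_matching] applies
    with [J = 0]. *)
Lemma stable_set_part eps p (x : int -> R) : eps < 1 -> X_part P p x ->
  @stable_set R X eps x `<=` X_part P p.
Proof.
move=> e1 Xx z [Wz zx]; have /X_spaceP[m Xz] := Wz.
rewrite -(X_part_matching P P_gt0 P_incr p m x z 0 Xx Xz)// => -[k _|//].
apply: le_lt_trans e1; apply: le_trans (zx k).
by apply: coord_le_tdist => //; apply/X_spaceP; exists p.
Qed.

(** The distance is below 1 from some time [N] on, so [X_part_matching] applies with [J = N]. *)
Lemma asymptotic_set_part p (x : int -> R) : X_part P p x ->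
  @asymptotic_set R X x `<=` X_part P p.
Proof.
move=> Xx z [Wz /cvgrPdist_lt/(_ 1 ltr01)[N _ zx]]; have /X_spaceP[m Xz] := Wz.
rewrite -(X_part_matching P P_gt0 P_incr p m x z N%:Z Xx Xz)// => -[k Nk|//].
have := zx k Nk; rewrite /= sub0r normrN; apply: le_lt_trans.
apply: le_trans (ler_norm _).
by apply: coord_le_tdist => //; apply/X_spaceP; exists p.
Qed.

(** [v] is the phase of the 2s. Negative coordinates read [u] at their absolute value, which keeps
    their letters in [G m] while the word sits on the coordinates from 0 on. *)
Definition word_point (m : nat) (v : int) (u : nat -> R) : int -> R :=
  fun i => if ((P m)%:Z %| i - v)%Z then 2 else u `|i|%N.

Definition base_letter (m : nat) : R := 2 ^- m + 1%:R * 2 ^- (m ^ 2)%N.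

Lemma G_base_letter m : G m (base_letter m).
Proof. by exists 1%N => //=; rewrite expn_gt0. Qed.

Lemma word_point_X m v u : (1 <= m)%N -> (forall j, G m (u j)) ->
  X_space P (word_point m v u).
Proof.
move=> m1 uG; right; exists m => //; exists (- v) => //.
exists (fun i => if ((P m)%:Z %| i)%Z then 2 else u `|(i + v)%R|%N).
  move=> i; split=> [/eqP|/eqP]; rewrite eqz_mod_dvd subr0; first by move=> ->.
  by move=> /negbTE ->.
by apply/funext => i; rewrite /zshift /word_point subrK.
Qed.

Lemma word_pointE m v u (j : nat) :
  (j %% P m != v %% P m)%N -> word_point m v%:Z u j%:Z = u j.
Proof.
move=> jv; rewrite /word_point ifN// -eqz_mod_dvd.
by apply: contra jv => /eqP; rewrite !modz_nat => -[->].
Qed.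

(** After [v] shifts the 2s of both points are aligned; elsewhere both letters lie in [G m], whose
    diameter is at most [2^-m]. *)
Lemma word_point_dist m (v : nat) u w k : (1 <= m)%N ->
  (forall j, G m (u j)) -> (forall j, G m (w j)) ->
  coord_dist (iter k (zshift 1) (iter v (zshift 1) (word_point m v%:Z u)))
             (iter k (zshift 1) (word_point m 0 w)) <= 2 ^- m.
Proof.
move=> m1 uG wG; rewrite !iter_zshift1; apply: seq_dist_le => i.
rewrite ler_pdivrMr ?exprn_gt0//; apply: (@le_trans _ _ (2 ^- m)); last first.
  by rewrite ler_peMr ?invr_ge0 ?exprn_ge0// exprn_ege1// ler1n.
rewrite /zshift /word_point addrK subr0; case: ifP => _.
  by rewrite subrr normr0 invr_ge0 exprn_ge0.
have /andP[? ?] := G_bounds _ _ m1 (uG `|(i + k%:Z + v%:Z)%R|%N).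
have /andP[? ?] := G_bounds _ _ m1 (wG `|(i + k%:Z)%R|%N).
by rewrite ler_norml; lra.
Qed.

Lemma expV2_le (eps : R) (m : nat) : 0 < eps -> (Num.trunc eps^-1 < m)%N ->
  2 ^- m <= eps.
Proof.
move=> e0 em; rewrite -[eps]invrK lef_pV2 ?posrE ?invr_gt0 ?exprn_gt0//.
apply: (@le_trans _ _ m%:R).
  by apply: le_trans (ltW (truncnS_gt _)) _; rewrite ler_nat.
by rewrite -natrX ler_nat ltnW// ltn_expl.
Qed.

(** The base point does not depend on [n]: a word is placed with its 2s in phase [n], so that they
    match those of the base point after [n] shifts. Large [m] makes all letters of [G m] agree up to
    [eps]. *)
Lemma preimage_words eps : 0 < eps -> exists m0, forall m, (1 <= m)%N -> (m0 <= m)%N ->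
  exists2 x : int -> R, X_space P x & forall n (u : nat -> R), (forall j, G m (u j)) ->
    exists2 z, @preimage_iter R X n (@stable_set R X eps x) z &
    forall j, (j %% P m)%N != (n %% P m)%N -> z j%:Z = u j.
Proof.
move=> e0; exists (Num.trunc eps^-1).+1 => m m1 em.
exists (word_point m 0 (fun=> base_letter m)).
  by apply: word_point_X => // j; exact: G_base_letter.
move=> n u uG; exists (word_point m n%:Z u); last by move=> j; exact: word_pointE.
have Wz := word_point_X m n%:Z u m1 uG.
split=> //; split=> [|k].
  have /X_spaceP[p Xz] := Wz; apply/X_spaceP; exists p.
  by rewrite /= iter_zshift1; apply/(zshift_X_part P).
apply: le_trans (expV2_le eps m e0 em).
by apply: word_point_dist => // j; exact: G_base_letter.
Qed.

(** Writing the word only at coordinates of absolute value below [n] changes finitely many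
    coordinates, which the shift carries away. *)
Lemma asymptotic_words m : (1 <= m)%N ->
  exists2 x : int -> R, X_space P x & forall n (u : nat -> R), (forall j, G m (u j)) ->
    exists2 z, @asymptotic_set R X x z &
    forall j, (j < n)%N -> (j %% P m)%N != 0%N -> z j%:Z = u j.
Proof.
move=> m1; pose g (j : nat) := base_letter m.
have gG j : G m (g j) by exact: G_base_letter.
exists (word_point m 0 g); first exact: word_point_X.
move=> n u uG; pose u' j := if (j < n)%N then u j else g j.
have u'G j : G m (u' j) by rewrite /u'; case: ifP.
exists (word_point m 0 u'); last first.
  by move=> j jn jP; rewrite (word_pointE m 0) ?mod0n// /u' jn.
split; first exact: word_point_X.
have half1 : `|2^-1 : R| < 1 by rewrite ger0_norm ?invr_ge0// invf_lt1// ltr1n.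
(* At time [k] a changed coordinate [i + k] satisfies [|i + k| < n], so its weight [2^-|i|] is at
   most [2^n * 2^-k]. *)
have cvg0 := @cvg_geometric R (2 ^+ n) 2^-1 half1.
apply: (squeeze_cvgr _ (cvg_cst 0) cvg0); apply: nearW => k; rewrite /geometric /=.
rewrite coord_dist_ge0/= !iter_zshift1; apply: seq_dist_le => i.
rewrite /zshift /word_point; case: ifP => _.
  by rewrite subrr normr0 mul0r mulr_ge0// exprn_ge0// invr_ge0.
rewrite /u'; case: ltnP => [ikn|_]; last first.
  by rewrite subrr normr0 mul0r mulr_ge0// exprn_ge0// invr_ge0.
apply: (@le_trans _ _ (2 ^+ `|i|%N)^-1).
  rewrite ler_piMl ?invr_ge0 ?exprn_ge0//.
  have /andP[? ?] := G_in01 _ _ m1 (uG `|(i + k%:Z)%R|%N).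
  have /andP[? ?] := G_in01 _ _ m1 (gG `|(i + k%:Z)%R|%N).
  by rewrite ler_norml; lra.
rewrite exprVn ler_pdivlMr ?exprn_gt0// mulrC ler_pdivrMr ?exprn_gt0//.
by rewrite -exprD ler_weXn2l ?ler1n//; lia.
Qed.

End FamiliesInX.

(** * The three kinds of dimensions of a product with X *)

Section DimensionsOfXTimes.
Context {R : realType} (P : nat -> nat) (S2 : dynsys R).
Hypothesis P_gt0 : forall m, (1 <= m)%N -> (1 <= P m)%N.
Hypothesis P_incr : forall m n, (1 <= m)%N -> (m < n)%N -> (P m < P n)%N.
Hypothesis tdistxx2 : forall y : ambient S2, tdist y y = 0.
Hypothesis tdist_ge02 : forall y z : ambient S2, 0 <= tdist y z.
Local Notation X := (@X_sys R P).
Local Notation XS := (prod_sys X S2).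

Lemma stable_dims eps : 0 < eps -> eps < 1 ->
  [/\ upD_int XS eps = (1%:E + upD_int S2 eps)%E,
      loD_int XS eps = (1%:E + loD_int S2 eps)%E,
      upD_ext XS eps = upD_ext S2 eps
    & loD_ext XS eps = loD_ext S2 eps].
Proof.
move=> e0 e1.
rewrite /upD_int /loD_int /upD_ext /loD_ext.
have -> : (fun w : ambient XS => htop (stable_set eps w)) =
    (fun w => growth XS (fun n => @stable_set R X eps w.1 `*` @stable_set R S2 eps w.2)).
  by apply/funext => w; rewrite stable_set_prod.
apply: (@dimensions_over_X R P S2 P_gt0 P_incr tdistxx2
  (fun=> @stable_set R X eps) (fun=> @stable_set R S2 eps)) => //.
- by move=> p _ x; exact: stable_set_part.
- by move=> _ x Wx; exists x; split=> // k; rewrite /= coord_distxx ltW.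
have [m0 Pre] := @preimage_words R P eps e0; exists m0 => m m1 mm0.
have [x Xx words] := Pre m m1 mm0; exists x => //; exists (fun=> 0%N) => n u uG.
(* For exponent 0 the preimage is the stable set itself, so one blocked class, that of 0, serves
   every length. *)
have [z [_ zx] zu] := words 0%N u uG; exists z => // j _ jP.
by apply: zu; rewrite mod0n.
Qed.

Lemma preimage_dims eps : 0 < eps -> eps < 1 ->
  [/\ upD_int_pre XS eps = (1%:E + upD_int_pre S2 eps)%E,
      loD_int_pre XS eps = (1%:E + loD_int_pre S2 eps)%E,
      upD_ext_pre XS eps = upD_ext_pre S2 eps
    & loD_ext_pre XS eps = loD_ext_pre S2 eps].
Proof.
move=> e0 e1.
rewrite /upD_int_pre /loD_int_pre /upD_ext_pre /loD_ext_pre.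
have -> : @preimage_entropy R XS eps =
    (fun w => growth XS (fun n => @preimage_iter R X n (@stable_set R X eps w.1)
                              `*` @preimage_iter R S2 n (@stable_set R S2 eps w.2))).
  apply/funext => w; apply/funext => delta; rewrite /preimage_entropy /growth.
  by congr limn_esup; apply/funext => n; rewrite stable_set_prod preimage_iter_prod.
apply: (@dimensions_over_X R P S2 P_gt0 P_incr tdistxx2
  (fun n x => @preimage_iter R X n (@stable_set R X eps x))
  (fun n y => @preimage_iter R S2 n (@stable_set R S2 eps y))) => //.
- move=> p n x Xx z [_ /(stable_set_part P P_gt0 P_incr _ _ _ e1 Xx)].
  by rewrite /= iter_zshift1 => /(zshift_X_part P).
(* The point [T^-n x] works, since [x] lies in its own stable set. *)
- move=> n x Wx; exists (zshift (- n%:Z) x).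
  have zx : iter n (zshift 1) (zshift (- n%:Z) x) = x.
    by rewrite iter_zshift1; apply/funext => i; rewrite /zshift addrK.
  split; last by rewrite /= zx; split=> // k; rewrite /= coord_distxx ltW.
  by move: Wx => /X_spaceP[p Xx]; apply/X_spaceP; exists p; apply/(zshift_X_part P).
have [m0 Pre] := @preimage_words R P eps e0; exists m0 => m m1 mm0.
have [x Xx words] := Pre m m1 mm0; exists x => //; exists (fun n => n %% P m)%N => n u uG.
by have [z zx zu] := words n u uG; exists z => // j _; exact: zu.
Qed.

Lemma asymptotic_dims :
  [/\ upD_int_as XS = (1%:E + upD_int_as S2)%E,
      loD_int_as XS = (1%:E + loD_int_as S2)%E,
      upD_ext_as XS = upD_ext_as S2
    & loD_ext_as XS = loD_ext_as S2].
Proof.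
rewrite /upD_int_as /loD_int_as /upD_ext_as /loD_ext_as.
have -> : (fun w : ambient XS => htop (asymptotic_set w)) =
    (fun w => growth XS (fun n => @asymptotic_set R X w.1 `*` @asymptotic_set R S2 w.2)).
  by apply/funext => w; rewrite asymptotic_set_prod//; exact: coord_dist_ge0.
apply: (@dimensions_over_X R P S2 P_gt0 P_incr tdistxx2
  (fun=> @asymptotic_set R X) (fun=> @asymptotic_set R S2)) => //.
- by move=> p _ x; exact: asymptotic_set_part.
- move=> _ x Wx; exists x; split=> //=.
  by rewrite (_ : (fun n => _) = cst 0); [exact: cvg_cst|apply/funext => k; exact: coord_distxx].
exists 0%N => m m1 _.
have [x Xx words] := @asymptotic_words R P m m1; exists x => //; exists (fun=> 0%N) => n u uG.
by have [z zx zu] := words n u uG; exists z.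
Qed.

End DimensionsOfXTimes.

Theorem proposition5p8 (R : realType) (P : nat -> nat)
    (hP1 : forall m, (1 <= m)%N -> (1 <= P m)%N)
    (hPincr : forall m n, (1 <= m)%N -> (m < n)%N -> (P m < P n)%N)
    (a b c : R) (ha : 0 <= a) (hab : a <= b) (hc : Num.max b 1 <= c)
    (E : set int) (hE : realizes a b c E)
    (eps : R) (heps0 : 0 < eps) (heps1 : eps < 1) :
  let XY := prod_sys (X_sys P) (Y_sys E c) in
  [/\ [/\ upD_int XY eps = (1 + b)%:E,
          upD_int_pre XY eps = (1 + b)%:E
        & upD_int_as XY = (1 + b)%:E],
      [/\ loD_int XY eps = (1 + a)%:E,
          loD_int_pre XY eps = (1 + a)%:E
        & loD_int_as XY = (1 + a)%:E],
      [/\ upD_ext XY eps = b%:E,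
          upD_ext_pre XY eps = b%:E
        & upD_ext_as XY = b%:E]
    & [/\ loD_ext XY eps = a%:E,
          loD_ext_pre XY eps = a%:E
        & loD_ext_as XY = a%:E]].
Proof.
move=> XY; rewrite {}/XY.
have c0 : c^-1 != 0.
  by rewrite invr_neq0// gt_eqF// (lt_le_trans _ hc)// lt_max ltr01 orbT.
have Yxx (y : ambient (Y_sys E c)) : tdist y y = 0 by rewrite /= rhoxx powR0.
have Yge0 (y z : ambient (Y_sys E c)) : 0 <= tdist y z by exact: powR_ge0.
have [/(_ eps heps0)[ui ue uip uep] [uia uea] /(_ eps heps0)[li le lip lep] [lia lea]] := hE.
have [-> -> -> ->] := @stable_dims R P (Y_sys E c) hP1 hPincr Yxx eps heps0 heps1.
have [-> -> -> ->] := @preimage_dims R P (Y_sys E c) hP1 hPincr Yxx eps heps0 heps1.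
have [-> -> -> ->] := @asymptotic_dims R P (Y_sys E c) hP1 hPincr Yxx Yge0.
by rewrite ui ue uip uep uia uea li le lip lep lia lea -!EFinD.
Qed.
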